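(* Let $G=(V,E,\bm{b})$ be a connected power network and let $\hat\ell=(\hat i,\hat j)\in E$ be a line that is not a bridge of $G$ (single non-bridge line outage). For any surviving line $\ell=(i,j)\in E$, $\ell\neq\hat\ell$, the following statements hold: (i) The power transfer distribution factor satisfies $D_{\ell\hat\ell}=0$ if and only if the line outage distribution factor satisfies $K_{\ell\hat\ell}=0$. (ii) If $\ell$ and $\hat\ell$ are in different blocks of $G$, then $K_{\ell\hat\ell}=0$ and $D_{\ell\hat\ell}=0$.
   Context: A power network $G=(V,E,\bm{b})$ is a finite simple undirected graph with $n=|V|$ vertices and $m=|E|$ edges (called lines), where each line $\ell=(i,j)$ has a weight (susceptance) $b_\ell=b_{ij}=b_{ji}>0$ and an arbitrary fixed orientation. $B=\mathrm{diag}(b_1,\dots,b_m)$; $C\in\{-1,0,1\}^{n\times m}$ is the vertex-edge incidence matrix ($C_{i\ell}=1$ if $i$ is the source of $\ell$, $-1$ if $i$ is the target of $\ell$, $0$ otherwise); $L=CBC^T$ is the weighted Laplacian and $L^\dag$ its Moore-Penrose pseudo-inverse. DC power flow: for an injection vector $\bm{p}\in\mathbb{R}^n$ that is balanced (for connected $G$: entries sum to zero), the line flows are $\bm{f}=BC^TL^\dag\bm{p}$. PTDF: for a line $\ell$ and nodes $s,t\in V$, $D_{\ell,st}$ is the change of the flow on $\ell$ divided by $\delta$ when $\bm{p}$ is changed to $\bm{p}+\delta(\mathbf{e}_s-\mathbf{e}_t)$, $\delta\neq0$. For a line $\hat\ell=(s,t)$ write $D_{\ell\hat\ell}=D_{\ell,st}$;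 equivalently, for $\ell=(i,j)$, $D_{\ell\hat\ell}=b_\ell(L^\dag_{is}+L^\dag_{jt}-L^\dag_{it}-L^\dag_{js})$. LODF: for a non-bridge line $\hat\ell$ and a line $\ell\neq\hat\ell$, $K_{\ell\hat\ell}=(\tilde f_\ell-f_\ell)/f_{\hat\ell}$, where $\bm{f}$ are the DC flows on $G$ and $\tilde{\bm{f}}$ the DC flows on the network obtained by deleting $\hat\ell$, for the same balanced injections $\bm{p}$ (with $f_{\hat\ell}\neq0$); this ratio does not depend on $\bm{p}$. A bridge is an edge whose deletion disconnects $G$. Blocks: two edges are equivalent if they are equal or there is a simple cycle containing both. The equivalence classes $E_1,\dots,E_k$ partition $E$; each class together with its endpoints is a block of $G$. A line belongs to the block of its equivalence class. *)

(* Defs.v *)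
From HB Require Import structures.
From mathcomp Require Import all_boot all_order all_algebra.

Set Implicit Arguments.
Unset Strict Implicit.
Unset Printing Implicit Defensive.

Import Order.TTheory GRing.Theory Num.Theory.
Local Open Scope ring_scope.

Definition is_mpinv (R : realFieldType) (m n : nat)
    (A : 'M[R]_(m, n)) (X : 'M[R]_(n, m)) : Prop :=
  [/\ A *m X *m A = A, X *m A *m X = X,
      (A *m X)^T = A *m X & (X *m A)^T = X *m A].

(* pinvmx is only a generalized inverse (it need not satisfy the
   symmetry conditions), so the Moore-Penrose inverse is built here from the
   full-rank factorization A = F *m G, with F = col_base A, G = row_base A. *)
Definition mpinv (R : realFieldType) (m n : nat) (A : 'M[R]_(m, n)) :
    'M[R]_(n, m) :=
  let F := col_base A in
  let G := row_base A in
  G^T *m invmx (G *m G^T) *m (invmx (F^T *m F) *m F^T).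

Lemma gram_unitmx (R : realFieldType) (r n : nat) (G : 'M[R]_(r, n)) :
  row_free G -> G *m G^T \in unitmx.
Proof.
move=> Gfree; rewrite -row_free_unit -kermx_eq0; apply/eqP/row_matrixP => i.
rewrite row0; set x := row i _.
have xGG : x *m (G *m G^T) = 0 by rewrite /x -row_mul mulmx_ker row0.
have : (x *m G) *m (x *m G)^T = 0.
  by rewrite trmx_mul !mulmxA -(mulmxA x) xGG mul0mx.
move=> /matrixP/(_ 0 0); rewrite !mxE => /eqP.
rewrite psumr_eq0 => [/allP xG0|j _]; last by rewrite !mxE -expr2 sqr_ge0.
apply: (row_free_inj Gfree); rewrite mul0mx; apply/rowP => j.
by have := xG0 j (mem_index_enum j); rewrite !mxE /= mulf_eq0 orbb => /eqP.
Qed.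

Lemma full_rank_mpinv (R : realFieldType) (m r n : nat)
    (F : 'M[R]_(m, r)) (G : 'M[R]_(r, n)) :
  row_full F -> row_free G ->
  is_mpinv (F *m G) (G^T *m invmx (G *m G^T) *m (invmx (F^T *m F) *m F^T)).
Proof.
move=> Ffull Gfree; have GU := gram_unitmx Gfree.
have FU : F^T *m F \in unitmx.
  by rewrite -{2}(trmxK F); apply: gram_unitmx; rewrite /row_free mxrank_tr.
set P := invmx (G *m G^T); set Q := invmx (F^T *m F).
have GP : G *m (G^T *m P) = 1%:M by rewrite mulmxA mulmxV.
have QF : (Q *m F^T) *m F = 1%:M by rewrite -mulmxA mulVmx.
have AX : F *m G *m (G^T *m P *m (Q *m F^T)) = F *m (Q *m F^T).
  by rewrite -(mulmxA F G) (mulmxA G) GP mul1mx.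
have XA : G^T *m P *m (Q *m F^T) *m (F *m G) = G^T *m P *m G.
  by rewrite -(mulmxA _ _ (F *m G)) (mulmxA _ F) QF mul1mx.
have PT : P^T = P by rewrite /P trmx_inv trmx_mul trmxK.
have QT : Q^T = Q by rewrite /Q trmx_inv trmx_mul trmxK.
split; rewrite ?AX ?XA.
- by rewrite -(mulmxA F) (mulmxA _ F) QF mul1mx.
- by rewrite -(mulmxA (_ *m P) G) (mulmxA G) GP mul1mx.
- by rewrite !trmx_mul trmxK QT mulmxA.
- by rewrite !trmx_mul trmxK PT mulmxA.
Qed.

Lemma mpinvP (R : realFieldType) (m n : nat) (A : 'M[R]_(m, n)) :
  is_mpinv A (mpinv A).
Proof.
have := full_rank_mpinv (col_base_full A) (row_base_free A).
by rewrite mulmx_base.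
Qed.

Lemma is_mpinv_uniq (R : realFieldType) (m n : nat)
    (A : 'M[R]_(m, n)) (X Y : 'M[R]_(n, m)) :
  is_mpinv A X -> is_mpinv A Y -> X = Y.
Proof.
move=> [AXA XAX AXT XAT] [AYA YAY AYT YAT].
have AXY : A *m X = A *m Y.
  by rewrite -{1}AYA -(mulmxA _ A X) -AYT -AXT -trmx_mul mulmxA AXA AYT.
have XYA : X *m A = Y *m A.
  by rewrite -{1}AYA -(mulmxA A) mulmxA -XAT -YAT -trmx_mul -mulmxA
             (mulmxA A) AXA YAT.
by rewrite -XAX XYA -mulmxA AXY mulmxA YAY.
Qed.

(* A simple undirected graph with vertices 'I_n and lines 'I_m; src and tgt
   give the arbitrary fixed orientation of the lines. *)
Record network (R : realFieldType) (n m : nat) := Network {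
  src : 'I_m -> 'I_n;
  tgt : 'I_m -> 'I_n;
  sus : 'I_m -> R;
  loopless : forall l, src l != tgt l;
  no_parallel : injective (fun l => [set src l; tgt l]);
  sus_gt0 : forall l, 0 < sus l
}.

Section Network.
Variables (R : realFieldType) (n : nat).

Section Graph.
Variables (m : nat) (N : network R n m).

Definition joins (l : 'I_m) (u v : 'I_n) : bool :=
  [set src N l; tgt N l] == [set u; v].

Definition adj : rel 'I_n := [rel u v | [exists l, joins l u v]].

Definition net_connected : bool :=
  [forall u, forall v, connect adj u v].

(* A simple cycle is given by its cyclic sequence of distinct vertices. *)
Definition simple_cycle (c : seq 'I_n) : Prop :=
  [/\ (2 < size c)%N, uniq c & cycle adj c].

Definition on_cycle (l : 'I_m) (c : seq 'I_n) : Prop :=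
  exists2 u, u \in c & joins l u (next c u).

Definition same_block (l l' : 'I_m) : Prop :=
  l = l' \/
  exists c, [/\ simple_cycle c, on_cycle l c & on_cycle l' c].

Definition susceptance_mx : 'M[R]_m := diag_mx (\row_l sus N l).

Definition incidence_mx : 'M[R]_(n, m) :=
  \matrix_(i, l) (if i == src N l then 1 else if i == tgt N l then -1 else 0).

Definition laplacian : 'M[R]_n :=
  incidence_mx *m susceptance_mx *m incidence_mx^T.

Definition flow (p : 'cV[R]_n) : 'cV[R]_m :=
  susceptance_mx *m incidence_mx^T *m mpinv laplacian *m p.

(* D_{l,st}, computed at injection p with step d. *)
Definition ptdf (p : 'cV[R]_n) (d : R) (l : 'I_m) (s t : 'I_n) : R :=
  (flow (p + d *: (delta_mx s 0 - delta_mx t 0)) l 0 - flow p l 0) / d.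

End Graph.

Definition balanced (p : 'cV[R]_n) : Prop := \sum_i p i 0 = 0.

Section Outage.
Variables (m : nat) (N : network R n m) (h : 'I_m).

Fact del_loopless (k : 'I_m.-1) : src N (lift h k) != tgt N (lift h k).
Proof. exact: loopless. Qed.

Fact del_no_parallel :
  injective (fun k : 'I_m.-1 => [set src N (lift h k); tgt N (lift h k)]).
Proof. by move=> k k' /no_parallel/lift_inj. Qed.

Fact del_sus_gt0 (k : 'I_m.-1) : 0 < sus N (lift h k).
Proof. exact: sus_gt0. Qed.

(* Surviving lines are renumbered: line k of del_line is line lift h k of N. *)
Definition del_line : network R n m.-1 :=
  Network del_loopless del_no_parallel del_sus_gt0.

Definition bridge : bool := ~~ net_connected del_line.

(* Flows after the outage of h, indexed by the lines of N. *)
Definition outage_flow (p : 'cV[R]_n) (l : 'I_m) : R :=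
  if unlift h l is Some k then flow del_line p k 0 else 0.

(* K_{l,h}, computed at injection p. *)
Definition lodf (p : 'cV[R]_n) (l : 'I_m) : R :=
  (outage_flow p l - flow N p l 0) / flow N p h 0.

End Outage.
End Network.

(* Main.v *)
Require Import Defs.
From mathcomp Require Import all_boot all_order all_algebra.
From mathcomp Require Import reals.

Set Implicit Arguments.
Unset Strict Implicit.
Unset Printing Implicit Defensive.

Import Order.TTheory GRing.Theory Num.Theory.
Local Open Scope ring_scope.

(** Put h = lhat = (s,t), and let phi be the potentials that carry a unit of
    power from s to t, so that D = flow N (e_s - e_t) is b_l (phi_i - phi_j) on
    each line l = (i,j), and the distribution factor of l is D_l ([ptdfE]).

    (i) Let theta be the potentials after the outage for the injections q. Used
    on the full network they also drive a flow alpha through h, so they solve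
    the power flow equations of N for the injections q + alpha (e_s - e_t)
    ([laplacian_del_line]). By uniqueness and linearity, the flow after the
    outage is f_l + alpha D_l on each surviving line l, while on h the same
    identity reads alpha = f_h + alpha D_h ([outage_flowE]). As f_h is nonzero,
    so is alpha, and K_l f_h = alpha D_l vanishes exactly when D_l does
    ([ptdf_lodf_eq0]).

    (ii) If D_l is nonzero, its endpoints have different potentials, say
    phi_i > phi_j. Power that enters a vertex other than t must leave it, so a
    walk along lines of strictly decreasing potential leads from j to t
    ([descent_to_sink]), and, replacing phi by - phi, one leads from s to i.
    Potential decreases strictly along the walk s .. i, j .. t, so it repeats
    no vertex, and h closes it into a simple cycle through l and h
    ([flow_same_block]). So D_l vanishes when l and h are in different blocks,
    and K_l does too by (i). *)

(** * Power flow on a network *)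

Lemma sum_delta (R : pzRingType) (I : finType) (s : I) (F : I -> R) :
  \sum_i (i == s)%:R * F i = F s.
Proof.
by rewrite (bigD1 s) //= eqxx mul1r big1 ?addr0 // => i /negPf->; rewrite mul0r.
Qed.

Lemma sum_delta_sub (R : pzRingType) (I : finType) (s t : I) (F : I -> R) :
  \sum_i ((i == s)%:R - (i == t)%:R) * F i = F s - F t.
Proof.
rewrite -(sum_delta s F) -(sum_delta t F) -sumrB.
by apply: eq_bigr => i _; rewrite mulrBl.
Qed.

Lemma submxE (R : zmodType) (m n : nat) (A B : 'M[R]_(m, n)) i j :
  (A - B) i j = A i j - B i j.
Proof. by rewrite !mxE. Qed.

Lemma addZmxE (R : pzRingType) (m n : nat) (A B : 'M[R]_(m, n)) a i j :
  (A + a *: B) i j = A i j + a * B i j.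
Proof. by rewrite !mxE. Qed.

(** The projection A A^+ fixes the range of A; being symmetric, it can be
    moved to the right of A when A is symmetric too. *)
Lemma mpinv_sym_proj (R : realFieldType) (n : nat) (A : 'M[R]_n) :
  A^T = A -> A *m (mpinv A *m A) = A /\ A *m (A *m mpinv A) = A.
Proof.
move=> AT; have [AXA _ AXT _] := mpinvP A; split; first by rewrite mulmxA.
by rewrite -AXT -{1}AT -trmx_mul AXA.
Qed.

Section PowerFlow.
Variables (R : realFieldType) (n m : nat) (N : network R n m).
Implicit Types (th q : 'cV[R]_n).

(** The vector of line flows driven by the nodal potentials [th]. *)
Definition tension_flow (th : 'cV[R]_n) : 'cV[R]_m :=
  susceptance_mx N *m (incidence_mx N)^T *m th.

(** The injections e_s - e_t, a unit entering at s and leaving at t. *)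
Definition transfer (s t : 'I_n) : 'cV[R]_n := delta_mx s 0 - delta_mx t 0.

Lemma incidenceE i l :
  incidence_mx N i l = (i == src N l)%:R - (i == tgt N l)%:R.
Proof.
rewrite mxE; have := loopless N l.
case: (eqVneq i (src N l)) => [->|_ _]; first by move=> /negPf->; rewrite subr0.
by case: eqP => _; rewrite sub0r ?oppr0.
Qed.

Lemma incidence_trE (th : 'cV[R]_n) l :
  ((incidence_mx N)^T *m th) l 0 = th (src N l) 0 - th (tgt N l) 0.
Proof.
rewrite mxE -(sum_delta_sub _ _ (fun i => th i 0)).
by apply: eq_bigr => i _; rewrite mxE incidenceE.
Qed.

Lemma tension_flowE th l :
  tension_flow th l 0 = sus N l * (th (src N l) 0 - th (tgt N l) 0).
Proof. by rewrite /tension_flow -mulmxA mul_diag_mx !mxE -incidence_trE mxE. Qed.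

Lemma laplacianE th : laplacian N *m th = incidence_mx N *m tension_flow th.
Proof. by rewrite /laplacian /tension_flow !mulmxA. Qed.

Lemma laplacian_entry th u :
  (laplacian N *m th) u 0 = \sum_l ((u == src N l)%:R - (u == tgt N l)%:R) *
    (sus N l * (th (src N l) 0 - th (tgt N l) 0)).
Proof.
by rewrite laplacianE mxE; apply: eq_bigr => l _; rewrite incidenceE tension_flowE.
Qed.

Lemma laplacian_sym : (laplacian N)^T = laplacian N.
Proof. by rewrite /laplacian !trmx_mul trmxK tr_diag_mx mulmxA. Qed.

(** The power dissipated by [th], namely the sum of b_l (th_i - th_j)^2, is
    th^T L th, so L th = 0 forces equal potentials along every line. *)
Lemma laplacian_ker th l :
  laplacian N *m th = 0 -> th (src N l) 0 = th (tgt N l) 0.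
Proof.
move=> Lth; have : (th^T *m (laplacian N *m th)) 0 0 = 0.
  by rewrite Lth mulmx0 mxE.
rewrite laplacianE mulmxA -[incidence_mx N]trmxK -trmx_mul mxE.
rewrite (eq_bigr (fun k => sus N k * (th (src N k) 0 - th (tgt N k) 0) ^+ 2)).
  move/eqP; rewrite psumr_eq0 => [/allP/(_ l (mem_index_enum l))|k _].
    by rewrite mulf_eq0 (gt_eqF (sus_gt0 N l)) sqrf_eq0 subr_eq0 => /eqP.
  by rewrite mulr_ge0 ?sqr_ge0 // ltW ?sus_gt0.
by move=> k _; rewrite mxE incidence_trE tension_flowE mulrCA expr2.
Qed.

Lemma flowE p : flow N p = tension_flow (mpinv (laplacian N) *m p).
Proof. by rewrite /flow /tension_flow mulmxA. Qed.

(** Any solution [th] of the power flow equations gives the flow: it differs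
    from L^+ L th by an element of the kernel of L, which drives no flow. *)
Lemma flow_laplacian th : flow N (laplacian N *m th) = tension_flow th.
Proof.
have [LXL _] := mpinv_sym_proj laplacian_sym.
rewrite flowE; apply/colP=> l; rewrite !tension_flowE.
set th' := mpinv _ *m _.
have/(laplacian_ker l): laplacian N *m (th' - th) = 0.
  by rewrite mulmxBr /th' (mulmxA (mpinv _)) [X in X - _]mulmxA LXL subrr.
rewrite !submxE => e; congr (_ * _).
by rewrite -[th' (src N l) 0](subrK (th (src N l) 0)) e addrAC [_ - th _ _]addrC
  addrK addrC.
Qed.

Lemma joins_adj l u v : joins N l u v -> adj N u v.
Proof. by move=> h; apply/existsP; exists l. Qed.

Lemma joins_sym l u v : joins N l u v = joins N l v u.
Proof. by rewrite /joins (setUC [set u]). Qed.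

Lemma joins_src_tgt l : joins N l (src N l) (tgt N l).
Proof. exact: eqxx. Qed.

Lemma joinsP l u v : joins N l u v ->
  src N l = u /\ tgt N l = v \/ src N l = v /\ tgt N l = u.
Proof.
move/eqP=> e; have := loopless N l.
have : src N l \in [set u; v] by rewrite -e set21.
have : tgt N l \in [set u; v] by rewrite -e set22.
have : u \in [set src N l; tgt N l] by rewrite e set21.
have : v \in [set src N l; tgt N l] by rewrite e set22.
rewrite !inE => /orP[]/eqP h1 /orP[]/eqP h2 /orP[]/eqP h3 /orP[]/eqP h4;
  by move: h1 h2 h3 h4; do 4![move=> ?]; move=> hs; auto; case/eqP: hs; congruence.
Qed.

Lemma joins_inj l l' u v : joins N l u v -> joins N l' u v -> l = l'.
Proof. by move=> /eqP e /eqP e'; apply: (@no_parallel _ _ _ N); rewrite e e'. Qed.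

Lemma laplacian_ker_const th : net_connected N -> laplacian N *m th = 0 ->
  forall u v, th u 0 = th v 0.
Proof.
move=> Nconn Lth u v; move/forallP/(_ u)/forallP/(_ v): Nconn.
case/connectP=> p; elim: p u => [|w p IHp] u /=; first by move=> _ ->.
case/andP=> /existsP[l /joinsP e] /IHp{}IHp /IHp<-.
by have := laplacian_ker l Lth; case: e => -[-> ->].
Qed.

Lemma sum_laplacian th : \sum_u (laplacian N *m th) u 0 = 0.
Proof.
rewrite (eq_bigr _ (fun u _ => laplacian_entry th u)) exchange_big /=.
apply: big1 => l _; exact: etrans (sum_delta_sub _ _ (fun=> _)) (subrr _).
Qed.

(** On a connected network every balanced injection is in the range of L: the
    residual q - L L^+ q is orthogonal to that range, hence in the kernel of
    the symmetric matrix L, hence constant, and its entries sum to 0. *)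
Lemma laplacian_mpinv q : net_connected N -> balanced q ->
  laplacian N *m (mpinv (laplacian N) *m q) = q.
Proof.
move=> Nconn qbal; have [_ LLX] := mpinv_sym_proj laplacian_sym.
pose r := q - laplacian N *m (mpinv (laplacian N) *m q).
have Lr : laplacian N *m r = 0.
  by rewrite /r mulmxBr [X in _ - _ *m X]mulmxA [X in _ - X]mulmxA LLX subrr.
have rC := laplacian_ker_const Nconn Lr.
have rsum : \sum_u r u 0 = 0.
  rewrite (eq_bigr (fun u => q u 0
    - (laplacian N *m (mpinv (laplacian N) *m q)) u 0)) => [|u _]; last first.
    by rewrite /r submxE.
  by rewrite sumrB sum_laplacian qbal subrr.
apply/eqP; rewrite eq_sym -subr_eq0 -/r; apply/eqP/colP=> u; rewrite [RHS]mxE.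
move/eqP: rsum; rewrite (eq_bigr (fun=> r u 0)) => [|v _]; last exact: rC.
rewrite sumr_const card_ord mulrn_eq0 => /orP[/eqP n0|/eqP//].
by have := ltn_ord u; rewrite {2}n0.
Qed.

Lemma flow_linear p a q l :
  flow N (p + a *: q) l 0 = flow N p l 0 + a * flow N q l 0.
Proof. by rewrite /flow mulmxDr -scalemxAr addZmxE. Qed.

Lemma transferE s t u : transfer s t u 0 = (u == s)%:R - (u == t)%:R.
Proof. by rewrite !mxE !andbT. Qed.

Lemma transfer_balanced s t : balanced (transfer s t).
Proof.
rewrite /balanced; transitivity (1 - 1 : R); last exact: subrr.
rewrite -(sum_delta_sub s t (fun=> 1)).
by apply: eq_bigr => u _; rewrite transferE mulr1.
Qed.

Lemma ptdfE p d l s t : d != 0 -> ptdf N p d l s t = flow N (transfer s t) l 0.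
Proof.
by move=> d0; rewrite /ptdf flow_linear addrC addKr mulrC mulKf.
Qed.

(** * Descending the potential *)

(** [descends th u v]: a line joins [u] to the vertex [v] of strictly lower
    potential. *)
Definition descends (th : 'cV[R]_n) : rel 'I_n :=
  [rel u v | adj N u v && (th v 0 < th u 0)].

(** If no power is withdrawn at [u], whatever enters [u] must leave it. *)
Lemma descends_next th u w :
  0 <= (laplacian N *m th) u 0 -> adj N u w -> th u 0 < th w 0 ->
  exists v, descends th u v.
Proof.
move=> Lu /existsP[k kuw] uw; apply/existsP; apply: contraTT Lu.
rewrite negb_exists => /forallP noexit.
have up l v : joins N l u v -> th u 0 <= th v 0.
  move=> /joins_adj a; rewrite leNgt; apply: contra (noexit v) => lt_vu.
  by apply/andP; split.
have term l v : joins N l u v ->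
    ((u == src N l)%:R - (u == tgt N l)%:R) *
    (sus N l * (th (src N l) 0 - th (tgt N l) 0))
    = sus N l * (th u 0 - th v 0).
  move=> luv; have := loopless N l.
  case: (joinsP luv) => -[-> ->]; rewrite eqxx.
    by move=> /negPf->; rewrite subr0 mul1r.
  by rewrite eq_sym => /negPf->; rewrite sub0r mulN1r -mulrN opprB.
rewrite laplacian_entry -ltNge (bigD1 k) //= -[ltRHS]addr0.
apply: ltr_leD.
  by rewrite (term _ _ kuw) pmulr_rlt0 ?sus_gt0 // subr_lt0.
apply: sumr_le0 => l _.
case: (eqVneq u (src N l)) => [us|us].
  have luv : joins N l u (tgt N l) by rewrite us joins_src_tgt.
  have := term _ _ luv; rewrite -us eqxx => ->.
  by rewrite pmulr_rle0 ?sus_gt0 // subr_le0 (up l).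
case: (eqVneq u (tgt N l)) => [ut|ut]; last by rewrite subr0 mul0r.
have luv : joins N l u (src N l) by rewrite joins_sym ut joins_src_tgt.
have := term _ _ luv; rewrite (negPf us) -ut eqxx => ->.
by rewrite pmulr_rle0 ?sus_gt0 // subr_le0 (up l).
Qed.

(** Starting where some power enters, a descent can be continued until it
    reaches [t], the only vertex where power may be withdrawn; it ends because
    potentials strictly decrease. *)
Lemma descent_to_sink th t u w :
    (forall v, v != t -> 0 <= (laplacian N *m th) v 0) ->
    adj N u w -> th u 0 < th w 0 ->
  exists2 p, path (descends th) u p & last u p = t.
Proof.
move=> Lth; have [k] := ubnP #|[set v | th v 0 < th u 0]|.
elim: k u w => // k IHk u w kP uw lt_uw.
have [<-|ut] := eqVneq u t; first by exists [::].
have [v duv] := descends_next (Lth u ut) uw lt_uw.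
have /andP[/existsP[l luv] lt_vu] := duv.
have [||p dp lp] := IHk v u _ _ lt_vu; last by exists (v :: p); rewrite //= duv.
  rewrite -ltnS; apply: leq_trans kP; rewrite ltnS; apply: proper_card.
  apply/properP; split.
    by apply/subsetP=> z; rewrite !inE => /lt_trans; apply.
  by exists v; rewrite !inE ?ltxx.
by apply: (@joins_adj l); rewrite joins_sym.
Qed.

Lemma descends_uniq th u p : path (descends th) u p -> uniq (u :: p).
Proof.
move=> dp; apply: (@sorted_uniq _ (relpre (fun v => th v 0) >%R)).
- by move=> y x z /= xy yz; apply: lt_trans xy.
- by move=> x /=; rewrite ltxx.
- by apply: sub_path dp => x y /andP[].
Qed.

End PowerFlow.

(** * Cycles through a current-carrying line *)

Lemma next_cat_cons (T : eqType) (a b : seq T) x y :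
  uniq (a ++ x :: y :: b) -> next (a ++ x :: y :: b) x = y.
Proof. by move=> u; rewrite -(next_rot (size a) u) rot_size_cat /= eqxx. Qed.

Lemma next_last (T : eqType) (x : T) p :
  uniq (x :: p) -> next (x :: p) (last x p) = x.
Proof.
move=> u; rewrite -(next_rot (size (belast x p)) u) lastI -cats1 rot_size_cat.
by case: p {u} => [|y p] /=; rewrite eqxx.
Qed.

Lemma flow_same_block (R : realFieldType) (n m : nat) (N : network R n m)
    (h l : 'I_m) :
  net_connected N -> l != h ->
  flow N (transfer R (src N h) (tgt N h)) l 0 != 0 -> same_block N l h.
Proof.
move=> Nconn lh; set s := src N h; set t := tgt N h.
rewrite flowE; set th := _ *m _.
have Lth : laplacian N *m th = transfer R s t.
  by rewrite laplacian_mpinv //; apply: transfer_balanced.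
move: th Lth => th Lth.
rewrite tension_flowE mulf_eq0 (gt_eqF (sus_gt0 N l)) /= subr_eq0 => th_neq.
have [i [j [lij lt_ji]]] : exists i j, joins N l i j /\ th j 0 < th i 0.
  move: th_neq; case: (ltgtP (th (src N l) 0)) => // lt_th _.
    by exists (tgt N l), (src N l); rewrite joins_sym joins_src_tgt.
  by exists (src N l), (tgt N l); rewrite joins_src_tgt.
have [p2 dp2 lp2] : exists2 p, path (descends N th) j p & last j p = t.
  apply: (@descent_to_sink _ _ _ _ _ _ j i) => //.
    move=> v /negPf vt; rewrite Lth transferE vt subr0; exact: ler0n.
  by apply: (@joins_adj _ _ _ _ l); rewrite joins_sym.
(* Climbing from i, that is descending for - th, ends at the source s. *)
have [p1 dp1 lp1] : exists2 p, path (descends N (- th)) i p & last i p = s.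
  apply: (@descent_to_sink _ _ _ _ _ _ i j); first 1 last.
  - exact: joins_adj lij.
  - by rewrite !mxE ltrN2.
  move=> v /negPf vs; rewrite mulmxN Lth mxE transferE vs sub0r opprK.
  exact: ler0n.
pose q := rev (belast i p1).
have dq : path (descends N th) s q.
  rewrite -lp1 rev_path; apply: sub_path dp1 => x y /andP[/existsP[k xy] lt_yx].
  apply/andP; split; last by move: lt_yx; rewrite !mxE ltrN2.
  by apply: (@joins_adj _ _ _ _ k); rewrite joins_sym.
have lq : last s q = i.
  by rewrite -lp1 /q; case: (p1) => //= x p; rewrite rev_cons last_rcons.
have dc : path (descends N th) s (q ++ j :: p2).
  have dij : descends N th i j by apply/andP; split=> //; apply: joins_adj lij.
  by rewrite cat_path dq lq; apply/andP; split=> //; apply/andP.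
have lc : last s (q ++ j :: p2) = t by rewrite last_cat.
have uc := descends_uniq dc.
right; exists (s :: q ++ j :: p2); split; first split=> //.
- (* A walk on two vertices would be the line l alone, parallel to h. *)
  case: (q) lq => [/= si|x q' _]; last by rewrite /= size_cat /= addnS.
  case: (p2) lp2 => [/= jt|//]; case/eqP: lh.
  by apply: (joins_inj lij); rewrite -si jt joins_src_tgt.
- rewrite /= rcons_path lc; apply/andP; split; last first.
    by apply: (@joins_adj _ _ _ _ h); rewrite joins_sym joins_src_tgt.
  by apply: sub_path dc => x y /andP[].
- exists i; first by rewrite -lq -cat_cons mem_cat mem_last.
  have e : s :: q ++ j :: p2 = belast s q ++ i :: j :: p2.
    by rewrite -cat_cons lastI lq cat_rcons.
  by move: uc; rewrite e => /next_cat_cons->.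
- exists t; first by rewrite -lc mem_last.
  by rewrite -{2}lc next_last // joins_sym joins_src_tgt.
Qed.

(** * The outage of a line *)

(** Putting the line [h] back under unchanged potentials [th] adds the flow it
    then carries to the injections. *)
Lemma laplacian_del_line (R : realFieldType) (n m : nat) (N : network R n m)
    (h : 'I_m) (th : 'cV[R]_n) :
  laplacian N *m th = laplacian (del_line N h) *m th
    + tension_flow N th h 0 *: transfer R (src N h) (tgt N h).
Proof.
apply/colP=> u; rewrite addZmxE transferE !laplacian_entry.
by rewrite (bigD1_ord h) //= addrC tension_flowE [in RHS]mulrC.
Qed.

(** The flow redistributed by the outage of [h] is a multiple of the response
    to a unit transfer between its endpoints; the multiple [a] is the flow
    that the potentials after the outage would drive through [h]. *)
Lemma outage_flowE (R : realFieldType) (n m : nat) (N : network R n m)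
    (h : 'I_m) (q : 'cV[R]_n) (D := flow N (transfer R (src N h) (tgt N h))) :
  ~~ bridge N h -> balanced q ->
  exists2 a, a = flow N q h 0 + a * D h 0
    & forall l, l != h -> outage_flow N h q l = flow N q l 0 + a * D l 0.
Proof.
rewrite negbK => Nconn qbal; pose th := mpinv (laplacian (del_line N h)) *m q.
have flE l : tension_flow N th l 0
    = flow N q l 0 + tension_flow N th h 0 * D l 0.
  rewrite -[in LHS]flow_laplacian (laplacian_del_line N h).
  by rewrite laplacian_mpinv // flow_linear.
exists (tension_flow N th h 0) => [|l lh]; first exact: flE.
rewrite -flE /outage_flow; case: unliftP lh => [k ->|->]; last by rewrite eqxx.
by rewrite flowE !tension_flowE.
Qed.

Lemma ptdf_lodf_eq0 (R : realFieldType) (n m : nat) (N : network R n m)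
    (h l : 'I_m) (q : 'cV[R]_n) :
  ~~ bridge N h -> l != h -> balanced q -> flow N q h 0 != 0 ->
  (lodf N h q l == 0) = (flow N (transfer R (src N h) (tgt N h)) l 0 == 0).
Proof.
move=> nb lh qbal fh; have [a aE outE] := outage_flowE nb qbal.
have a0 : a != 0.
  by apply: contraNneq fh => a0; move: aE; rewrite a0 mul0r addr0 => <-.
rewrite /lodf outE // addrC addKr mulf_eq0 invr_eq0 (negPf fh) orbF.
by rewrite mulf_eq0 (negPf a0).
Qed.

Theorem proposition4p2 (R : realType) (n m : nat) (N : network R n m)
    (lhat l : 'I_m)
    (Gconn : net_connected N) (nonbridge : ~~ bridge N lhat)
    (surviving : l != lhat) :
  (forall (p q : 'cV[R]_n) (delta : R),
     balanced p -> delta != 0 ->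
     balanced q -> flow N q lhat 0 != 0 ->
     (ptdf N p delta l (src N lhat) (tgt N lhat) = 0 <-> lodf N lhat q l = 0))
  /\
  (~ same_block N l lhat ->
     (forall q : 'cV[R]_n,
        balanced q -> flow N q lhat 0 != 0 -> lodf N lhat q l = 0)
     /\
     (forall (p : 'cV[R]_n) (delta : R),
        balanced p -> delta != 0 ->
        ptdf N p delta l (src N lhat) (tgt N lhat) = 0)).
Proof.
split=> [p q delta _ delta0 qbal fh | diff_blocks].
  rewrite ptdfE //; have e := ptdf_lodf_eq0 nonbridge surviving qbal fh.
  by split=> /eqP; [rewrite -e | rewrite e] => /eqP.
have D0 : flow N (transfer R (src N lhat) (tgt N lhat)) l 0 = 0.
  by apply/eqP; apply: contra_notT diff_blocks; apply: flow_same_block.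
split=> [q qbal fh | p delta _ delta0]; last by rewrite ptdfE.
by apply/eqP; rewrite ptdf_lodf_eq0 // D0.
Qed.
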